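(* Suppose $n$ balls are assigned independently to $m$ urns, each ball being assigned to each urn with probability $p=1/m$, and let $S_j$ denote the number of balls assigned to urn $j$, $j=1,\ldots,m$. Suppose each urn has capacity for $k-1$ balls, where $k\ge1$ is an integer, and let $$W=\sum_{j=1}^mY_j,\qquad Y_j=(S_j-k+1)\mathbf{1}(S_j\geq k),$$ be the total number of excess balls. Let $\sigma^2=\mathrm{Var}(W)$, with $\sigma^2>0$. Then $$d_{\mathrm W}(\widetilde{W},\widetilde{Z})\leq\frac{\mathbb{E}[Y_1^3]}{\sigma\,\mathbb{E}[Y_1^2]}+\sqrt{\frac{8}{\pi}}\,m\,\sigma^{-2}\left((1-m)\mathrm{Cov}(Y_1,Y_2)+(\mathbb{E}[Y_1])^2\right),$$ where $\widetilde{W}=\sigma^{-1}(W-\mathbb{E}W)$ and $\widetilde{Z}\sim\mathrm{N}(0,1)$.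
   Context: $\mathbf{1}(\cdot)$ is the indicator function. Wasserstein distance: $d_{\mathrm W}(X,X')=\sup\{|\mathbb{E}h(X)-\mathbb{E}h(X')|: |h(x)-h(y)|\le|x-y| \text{ for all } x,y\in\mathbb{R}\}$. *)

(* Defs.v *)
From mathcomp Require Import all_boot all_order all_algebra.
From mathcomp Require Import all_classical all_reals all_analysis.

Set Implicit Arguments.
Unset Strict Implicit.
Unset Printing Implicit Defensive.

Import Order.TTheory GRing.Theory Num.Theory.
Import numFieldNormedType.Exports.

Local Open Scope classical_set_scope.
Local Open Scope ring_scope.

(* Random elements of a finite type [U] with its discrete sigma-algebra; [U] need
   not be inhabited, hence cannot be made a [measurableType]. *)
Definition finite_random_element (d : measure_display) (T : measurableType d)
    (U : finType) (X : T -> U) : Prop :=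
  forall u : U, measurable (X @^-1` [set u]).

Definition mutually_independent (d : measure_display) (T : measurableType d)
    (R : realType) (P : probability T R) (I U : finType)
    (X : I -> T -> U) : Prop :=
  forall (J : {set I}) (A : I -> set U),
    P (\bigcap_(i in [set i | i \in J]) (X i @^-1` A i)) =
    (\prod_(i in J) P (X i @^-1` A i))%E.

(* The law is compared with [normal_prob] on Borel sets only: the value of a
   measure on a non-measurable set is arbitrary. *)
Definition normally_distributed (d : measure_display) (T : measurableType d)
    (R : realType) (P : probability T R) (Z : {RV P >-> R}) (mu s : R) : Prop :=
  forall A : set R, measurable A -> distribution P Z A = normal_prob mu s A.

(* A distance between laws: the two variables may live on different spaces. *)
Definition wasserstein_distance (d d' : measure_display)
    (T : measurableType d) (T' : measurableType d') (R : realType)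
    (P : probability T R) (P' : probability T' R)
    (X : T -> R) (X' : T' -> R) : \bar R :=
  ereal_sup [set (`| 'E_P[h \o X] - 'E_P'[h \o X'] |)%E | h in
    [set h : R -> R | forall x y, `|h x - h y| <= `|x - y|]].

Section urns.
Variables (T : Type) (R : realType) (n m : nat) (X : 'I_n -> T -> 'I_m).

(* [X i w] is the urn receiving ball [i].  Urns are numbered from 0, and a label
   [j >= m] denotes no urn, so that [load j] is then 0. *)
Definition load (j : nat) (w : T) : nat :=
  #|[pred i : 'I_n | X i w == j :> nat]|.

(* The difference is taken in [R], where it is not truncated. *)
Definition excess (k j : nat) (w : T) : R :=
  ((load j w)%:R - k%:R + 1) * \1_[set w | (k <= load j w)%N] w.

Definition total_excess (k : nat) (w : T) : R := \sum_(j < m) excess k j w.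

End urns.

(* Main.v *)
Require Import Defs.
From mathcomp Require Import all_boot all_order all_algebra all_fingroup.
From mathcomp Require Import all_classical all_reals all_analysis.
From mathcomp Require Import measurable_realfun.
From mathcomp Require Import ring lra zify.

(** The proof is Stein's method with a size-bias coupling.  Let [f] solve
    [f'(w) - w f(w) = h(w) - E h(Z)] for a 1-Lipschitz [h]; the quantity to bound
    is [E (f'(Wt) - Wt f(Wt))].  Put [g(v) = f((v - E W) / sigma)].

    By exchangeability of the urns, [E (W g(W)) = m E (Y g(W))] with [Y] the excess
    of urn 0.  Take two independent allocations, the second one supplying [Y].
    Given the content of urn 0 in the second allocation, its other balls can be
    placed according to the first one: after an exchange that preserves the joint
    law ([swap]), the second allocation has a total excess [V'] with
    [V' <= W + Y] whenever [Y > 0] ([total_overflow_swap]), where now [W] is the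
    total excess of the first allocation and is independent of [Y].  This is the
    form in which negative dependence of the urns is used.  Hence
    [sigma * E (Wt f(Wt)) = m E (Y (g(W + Y) - g(W))) - m E (Y (g(W + Y) - g(V')))].

    By Taylor's formula and independence, the first term is
    [m E (Y^2) E f'(Wt) / sigma] up to [m E (Y^3) / sigma^2] when [f'] is
    2-Lipschitz, and the second one is at most
    [sup |f'| / sigma * m E (Y (W + Y - V'))].  Here
    [m E (Y (W + Y - V'))] equals [m E (Y^2) - sigma^2], which is
    [m ((1 - m) Cov(Y_0, Y_1) + (E Y_0)^2)] after expanding [sigma^2]; comparing
    the coefficient [m E (Y^2)] with [sigma^2] costs the same amount once more.
    This is [stein_size_bias].

    What remains are the sharp bounds [|f'| <= sqrt(2 / pi) = 2 phi(0)]
    ([stein'_bound]) and the 2-Lipschitz property of [f'] ([stein'_lipschitz]).  Both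
    follow from writing [f], [f'] and [(w f)'] in terms of the two one-sided
    Gaussian integrals of [h - h(w)], and from inequalities between the normal
    density and distribution function: [mean_excess_product] for the first, bounds
    on the Mills ratio for the second. *)

Set Implicit Arguments.
Unset Strict Implicit.
Unset Printing Implicit Defensive.

Import Order.TTheory GRing.Theory Num.Theory.
Import numFieldNormedType.Exports.

(** * A coupling of two allocations that exhibits negative dependence *)

Section front_perm.
Variable n : nat.
Implicit Types A B : {set 'I_n}.

(** Listing the elements of [B] before the others and sending each element to
    its position in the list gives such a permutation. *)
Lemma exists_front_perm B :
  exists r : {perm 'I_n}, forall i, (r i < #|B|) = (i \in B).
Proof.
pose s := enum B ++ enum (~: B).
have sB : size s = n by rewrite size_cat -!cardE cardsC card_ord.
have ms i : i \in s by rewrite mem_cat !mem_enum finset.in_setC orbN.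
have lt_s i : index i s < n by rewrite -[X in _ < X]sB index_mem.
have f_inj : injective (fun i => Ordinal (lt_s i)).
  by move=> i j /(congr1 val)/= E; rewrite -(nth_index i (ms i)) E nth_index.
exists (perm f_inj) => i; rewrite permE/= index_cat mem_enum cardE.
have [iB|iB] := boolP (i \in B); first by rewrite index_mem mem_enum.
by rewrite ltnNge leq_addr.
Qed.

Definition front_perm B : {perm 'I_n} :=
  odflt 1%g [pick r : {perm 'I_n} | [forall i, (r i < #|B|) == (i \in B)]].

Lemma front_permP B i : (front_perm B i < #|B|) = (i \in B).
Proof.
rewrite /front_perm; case: pickP => [r /forallP/(_ i)/eqP//|].
have [r rB] := exists_front_perm B.
by move=> /(_ r)/negP[]; apply/forallP => j; rewrite rB.
Qed.

(** [front_perm] puts [A] and [B] on initial segments of ['I_n]; going through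
    that common order makes the image of [A] and the set [B] comparable for
    inclusion, whichever is larger. *)
Definition nesting_perm A B : {perm 'I_n} :=
  (front_perm A * (front_perm B)^-1)%g.

Lemma mem_nesting_perm A B i :
  (nesting_perm A B i \in B) = (front_perm A i < #|B|).
Proof. by rewrite /nesting_perm permM -front_permP permKV. Qed.

(** The two sets being nested, the part of the preimage of [B] outside [A] is
    empty when [#|B| <= #|A|] and otherwise a set difference. *)
Lemma card_nesting_perm A B :
  #|[set i | (i \notin A) && (nesting_perm A B i \in B)]| <= #|B| - #|A|.
Proof.
set p := nesting_perm A B; set D := [set i | _].
have DE : D = (p @^-1: B) :\: A by apply/setP => i; rewrite !inE.
have [AB|BA] := leqP #|A| #|B|.
  have ApB : A \subset p @^-1: B.
    apply/fintype.subsetP => i; rewrite inE mem_nesting_perm -front_permP => iA.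
    exact: leq_trans AB.
  by rewrite DE cardsD (finset.setIidPr ApB) card_preimset//; exact: perm_inj.
rewrite (_ : D = finset.set0) ?cards0//; apply/setP => i; rewrite !inE.
rewrite mem_nesting_perm -front_permP -leqNgt; apply/negP => /andP[h1 h2].
by have := leq_ltn_trans h1 h2; rewrite ltnNge (ltnW BA).
Qed.

End front_perm.

Section urn_coupling.
Variables (n m k : nat) (j0 : 'I_m).
Implicit Types (x : {ffun 'I_n -> 'I_m}).
Implicit Types (p : {ffun 'I_n -> 'I_m} * {ffun 'I_n -> 'I_m}).

Definition balls_in x (j : 'I_m) : {set 'I_n} := [set i | x i == j].

(** For [k >= 1] this truncated difference is the excess
    [(S_j - k + 1) 1(S_j >= k)]. *)
Definition overflow x (j : 'I_m) : nat := #|balls_in x j|.+1 - k.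

Definition total_overflow x : nat := \sum_(j < m) overflow x j.

Definition coupling_perm p := nesting_perm (balls_in p.2 j0) (balls_in p.1 j0).

(** Two independent allocations exchange the destinations of the balls [i] (in
    the second) and [coupling_perm p i] (in the first), unless one of them lies
    in urn [j0].  The contents of urn [j0] are unchanged in both allocations,
    hence so is [coupling_perm p], and [swap] is an involution: it preserves the
    uniform law on pairs.  In the second component the balls outside urn [j0]
    now follow the first allocation, except for those whose partner was in
    urn [j0] there; nesting makes these as few as possible. *)
Definition swap p : {ffun 'I_n -> 'I_m} * {ffun 'I_n -> 'I_m} :=
  let s := coupling_perm p in
  ([ffun i => if (p.1 i != j0) && (p.2 (s^-1 i)%g != j0)
              then p.2 (s^-1 i)%g else p.1 i],
   [ffun i => if (p.1 (s i) != j0) && (p.2 i != j0) then p.1 (s i) else p.2 i]).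

Lemma balls_in_swap1 p : balls_in (swap p).1 j0 = balls_in p.1 j0.
Proof.
apply/setP => i; rewrite !inE ffunE.
by case: ifP => // /andP[/negbTE-> /negbTE->].
Qed.

Lemma balls_in_swap2 p : balls_in (swap p).2 j0 = balls_in p.2 j0.
Proof.
apply/setP => i; rewrite !inE ffunE.
by case: ifP => // /andP[/negbTE-> /negbTE->].
Qed.

Lemma swapK : involutive swap.
Proof.
move=> p; have E : coupling_perm (swap p) = coupling_perm p.
  by rewrite /coupling_perm balls_in_swap1 balls_in_swap2.
rewrite [RHS]surjective_pairing {1}/swap E; set s := coupling_perm p.
congr (_, _); apply/ffunP => i; rewrite !ffunE -/s ?permKV ?permK.
  have [->|a] := eqVneq (p.1 i) j0; first by rewrite eqxx.
  have [->|b] := eqVneq (p.2 _) j0; first by rewrite /= (negbTE a) eqxx.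
  by rewrite /= a b.
have [->|a] := eqVneq (p.2 i) j0; first by rewrite andbF/= eqxx andbF.
have [->|b] := eqVneq (p.1 _) j0; first by rewrite /= eqxx.
by rewrite /= a b.
Qed.

Lemma overflow_swap2 p : overflow (swap p).2 j0 = overflow p.2 j0.
Proof. by rewrite /overflow balls_in_swap2. Qed.

(** A ball in urn [j] after the swap either has its partner in urn [j] of the
    first allocation, or was not swapped because its partner is in urn [j0]. *)
Lemma balls_in_swap_le p (j : 'I_m) : j != j0 ->
  #|balls_in (swap p).2 j| <= #|balls_in p.1 j| +
    #|[set i | (p.2 i == j) && (coupling_perm p i \in balls_in p.1 j0)]|.
Proof.
move=> jj0; set s := coupling_perm p.
rewrite -(card_preimset (balls_in p.1 j) (@perm_inj _ s)).
rewrite (leq_trans _ (leq_card_setU _ _))//.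
apply/subset_leq_card/fintype.subsetP => i.
rewrite !inE ffunE -/s; case: ifPn => [/andP[_ _] ->//|].
rewrite negb_and !negbK => /orP[->|/eqP->]; first by rewrite andbT orbC => ->.
by rewrite eq_sym (negbTE jj0).
Qed.

Lemma sum_card_fibers (A : {set 'I_n}) (x : {ffun 'I_n -> 'I_m}) :
  \sum_(j | j != j0) #|[set i | (x i == j) && (i \in A)]| =
  #|[set i | (i \notin balls_in x j0) && (i \in A)]|.
Proof.
rewrite -[RHS]sum1_card (partition_big x (fun j => j != j0))/=; last first.
  by move=> i; rewrite !inE => /andP[].
apply: eq_bigr => j jj0; rewrite -sum1_card; apply: eq_bigl => i.
by rewrite !inE; case: eqP => [->|]; rewrite ?andbF// jj0 andbT.
Qed.

(** Negative dependence in coupled form.  Let urn [j0] hold [r] balls in the first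
    allocation and [s] in the second; [s >= k] since it overflows.  Altogether the
    other urns receive at most [r - s] balls more than in the first allocation, and
    each ball adds at most one to the overflow; as [r - s <= r - k + 1], this is
    paid for by the overflow of urn [j0] in the first allocation. *)
Lemma total_overflow_swap p : 0 < overflow p.2 j0 ->
  total_overflow (swap p).2 <= total_overflow p.1 + overflow p.2 j0.
Proof.
move=> Y0; rewrite /total_overflow (bigD1 j0)//= overflow_swap2 addnC leq_add2r.
rewrite [leqRHS](bigD1 j0)//= addnC.
pose s := coupling_perm p.
pose e j := #|[set i | (p.2 i == j) && (s i \in balls_in p.1 j0)]|.
apply: (@leq_trans (\sum_(j | j != j0) (overflow p.1 j + e j))).
  apply: leq_sum => j jj0; have := balls_in_swap_le p jj0.
  rewrite -/s -/(e j) /overflow.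
  move: #|balls_in (swap p).2 j| #|balls_in p.1 j| (e j) => a b c; lia.
rewrite big_split/= leq_add2l.
have -> : \sum_(j | j != j0) e j =
    #|[set i | (i \notin balls_in p.2 j0) && (s i \in balls_in p.1 j0)]|.
  have := sum_card_fibers (s @^-1: balls_in p.1 j0) p.2.
  have Ee j : e j =
      #|[set i | (p.2 i == j) && (i \in s @^-1: balls_in p.1 j0)]|.
    by congr #|pred_of_set _|; apply/setP => i; rewrite !inE.
  under eq_bigr do rewrite -Ee.
  move=> ->; congr #|pred_of_set _|; apply/setP => i; by rewrite !inE.
apply: leq_trans (card_nesting_perm _ _) _.
move: Y0; rewrite /overflow.
move: #|balls_in p.1 j0| #|balls_in p.2 j0| => a b; lia.
Qed.

End urn_coupling.

Local Open Scope ring_scope.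

(** * Stein's method on a finite uniform space *)

Section uniform_average.
Variables (R : realFieldType) (Omega : finType).

Definition avg (g : Omega -> R) : R := (\sum_x g x) / #|Omega|%:R.

Lemma avgD g1 g2 : avg (fun x => g1 x + g2 x) = avg g1 + avg g2.
Proof. by rewrite /avg big_split mulrDl. Qed.

Lemma avgZ c g : avg (fun x => c * g x) = c * avg g.
Proof. by rewrite /avg -mulr_sumr mulrA. Qed.

Lemma avgB g1 g2 : avg (fun x => g1 x - g2 x) = avg g1 - avg g2.
Proof. by rewrite /avg sumrB mulrBl. Qed.

Lemma eq_avg g1 g2 : g1 =1 g2 -> avg g1 = avg g2.
Proof. by move=> E; rewrite /avg (eq_bigr _ (fun x _ => E x)). Qed.

Lemma avg_sum (I : finType) (P : pred I) (g : I -> Omega -> R) :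
  avg (fun x => \sum_(i | P i) g i x) = \sum_(i | P i) avg (g i).
Proof. by rewrite /avg exchange_big/= mulr_suml. Qed.

Lemma le_avg g1 g2 : (forall x, g1 x <= g2 x) -> avg g1 <= avg g2.
Proof. by move=> le12; rewrite /avg ler_wpM2r ?invr_ge0// ler_sum. Qed.

Lemma normr_avg g : `|avg g| <= avg (fun x => `|g x|).
Proof.
by rewrite /avg normrM normfV normr_nat ler_wpM2r ?invr_ge0// ler_norm_sum.
Qed.

Lemma avg_ge0 g : (forall x, 0 <= g x) -> 0 <= avg g.
Proof. by move=> g0; rewrite /avg divr_ge0// sumr_ge0. Qed.

Lemma avg_cst (c : R) : (0 < #|Omega|)%N -> avg (fun=> c) = c.
Proof.
move=> N0; rewrite /avg -[\sum_x c]/(\sum_(x in Omega) c) sumr_const.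
by rewrite -[c *+ _]mulr_natr mulfK// pnatr_eq0 -lt0n.
Qed.

End uniform_average.

Section avg_pair.
Variables (R : realFieldType) (Omega : finType).

Lemma avg_pair (g : Omega * Omega -> R) :
  avg g = avg (fun x => avg (fun x' => g (x, x'))).
Proof.
rewrite /avg -mulr_suml card_prod natrM invfM mulrA; congr (_ / _ / _).
by rewrite pair_bigA; apply: eq_bigr => -[].
Qed.

Lemma avg_prod (g1 g2 : Omega -> R) :
  avg (fun p : Omega * Omega => g1 p.1 * g2 p.2) = avg g1 * avg g2.
Proof.
rewrite avg_pair; under eq_avg do rewrite /= avgZ mulrC.
by rewrite avgZ mulrC.
Qed.

End avg_pair.

(** Setting of Stein's method by size-bias coupling on a finite uniform space:
    [m * avg (Y * g W) = avg (W * g W)] says that the law of [W] weighted by [Y]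
    is the size-biased law of [W].  On pairs [(x, x')], the variables [W x] and
    [Y x'] are independent, while [V'] weighted by [Y x'] also has the
    size-biased law; where [Y x' > 0], it is dominated by the sum of the two. *)
Section stein_size_bias.
Variables (R : realFieldType) (Omega : finType) (m : R).
Variables (W Y : Omega -> R) (V' : Omega * Omega -> R).
Hypothesis m_ge0 : 0 <= m.
Hypothesis Omega_gt0 : (0 < #|Omega|)%N.
Hypothesis Y_ge0 : forall x, 0 <= Y x.
Hypothesis sum_Y : forall g : R -> R,
  avg (fun x => W x * g (W x)) = m * avg (fun x => Y x * g (W x)).
Hypothesis V'_law : forall g : R -> R,
  avg (fun p => Y p.2 * g (V' p)) = avg (fun x => Y x * g (W x)).
Hypothesis V'_le : forall p, 0 < Y p.2 -> V' p <= W p.1 + Y p.2.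

Let lambda := avg W.
Variables (sigma c : R) (f f' : R -> R).
Hypothesis sigma_gt0 : 0 < sigma.
Hypothesis sigmaE : sigma ^+ 2 = avg (fun x => W x ^+ 2) - lambda ^+ 2.
Hypothesis f_lip : forall x y, `|f x - f y| <= c * `|x - y|.
Hypothesis f_taylor : forall x y, x <= y ->
  `|f y - f x - (y - x) * f' x| <= (y - x) ^+ 2.

Let w v := sigma^-1 * (v - lambda).
(* [a] compares [W] with the sum [W + Y] of independent terms; [b] compares
   this sum with the size-biased variable [V'] that it dominates. *)
Let a p := Y p.2 * (f (w (W p.1 + Y p.2)) - f (w (W p.1))).
Let b p := Y p.2 * (f (w (W p.1 + Y p.2)) - f (w (V' p))).

Let avg_snd (g : Omega -> R) : avg (fun p : Omega * Omega => g p.2) = avg g.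
Proof.
have := avg_prod (fun=> 1) g; rewrite avg_cst// mul1r => <-.
by apply: eq_avg => p; rewrite mul1r.
Qed.

Let lambdaE : lambda = m * avg Y.
Proof.
have := sum_Y (fun=> 1).
under eq_avg do rewrite mulr1.
by under [X in _ * X]eq_avg do rewrite mulr1.
Qed.

Let avg_W2 : m * avg (fun x => Y x * W x) = sigma ^+ 2 + lambda ^+ 2.
Proof.
by rewrite sigmaE subrK -(sum_Y id); apply: eq_avg => x; rewrite expr2.
Qed.

Let avg_wfw :
  avg (fun x => w (W x) * f (w (W x))) = sigma^-1 * m * (avg a - avg b).
Proof.
have -> : avg a - avg b =
    avg (fun x => Y x * f (w (W x))) - avg Y * avg (fun x => f (w (W x))).
  rewrite -avgB -(V'_law (f \o w)) mulrC -avg_prod -avgB.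
  by apply: eq_avg => p; rewrite /a /b/=; ring.
have := sum_Y (f \o w); rewrite /= => E.
rewrite -mulrA mulrBr -E mulrA -lambdaE -avgZ -avgB -avgZ.
by apply: eq_avg => x; rewrite /w; ring.
Qed.

Let wY x y : w (x + y) - w x = sigma^-1 * y. Proof. rewrite /w; ring. Qed.

(** The linear term of the Taylor expansion factors by independence. *)
Let a_taylor :
  `|avg a - sigma^-1 * avg (fun x => Y x ^+ 2) * avg (fun x => f' (w (W x)))| <=
  avg (fun x => Y x ^+ 3) / sigma ^+ 2.
Proof.
rewrite -(mulrA sigma^-1) [avg (fun=> _ ^+ 2) * _]mulrC -avg_prod -avgZ -avgB.
rewrite (le_trans (normr_avg _))// mulrC -avg_snd -avgZ; apply: le_avg => p.
rewrite /a; set x := W p.1; set y := Y p.2.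
have y0 : 0 <= y by exact: Y_ge0.
have := f_taylor (x := w x) (y := w (x + y)); rewrite -subr_ge0 wY.
move=> /(_ (mulr_ge0 (ltW _) y0)); rewrite invr_gt0 => /(_ sigma_gt0).
move=> H; have := ler_wpM2l y0 H; rewrite -{1}(ger0_norm y0) -normrM.
have -> : y * (f (w (x + y)) - f (w x) - sigma^-1 * y * f' (w x)) =
  y * (f (w (x + y)) - f (w x)) - sigma^-1 * (f' (w x) * y ^+ 2) by ring.
move=> /le_trans; apply; rewrite le_eqVlt; apply/orP; left; apply/eqP.
by field; rewrite gt_eqF.
Qed.

Let a_le : `|avg a| <= c * avg (fun x => Y x ^+ 2) / sigma.
Proof.
rewrite (le_trans (normr_avg _))// mulrC mulrA -avg_snd -avgZ.
apply: le_avg => p; rewrite /a normrM (ger0_norm (Y_ge0 _)).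
have := f_lip (w (W p.1 + Y p.2)) (w (W p.1)); rewrite wY normrM.
rewrite (ger0_norm (Y_ge0 _)) gtr0_norm ?invr_gt0// => H.
have := ler_wpM2l (Y_ge0 p.2) H; move=> /le_trans; apply.
by rewrite le_eqVlt; apply/orP; left; apply/eqP; ring.
Qed.

(** Computed through the size bias, the variance of [W] is [m] times the mean of
    [Y * (V' - W)]. *)
Let deficitE : m * avg (fun x => Y x ^+ 2) - sigma ^+ 2 =
  m * avg (fun p => Y p.2 * (W p.1 + Y p.2 - V' p)).
Proof.
have -> : avg (fun p => Y p.2 * (W p.1 + Y p.2 - V' p)) =
    lambda * avg Y + avg (fun x => Y x ^+ 2) - avg (fun x => Y x * W x).
  rewrite -(V'_law id) -[avg (fun x => Y x ^+ 2)]avg_snd -avg_prod -avgD -avgB.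
  by apply: eq_avg => p; ring.
by rewrite mulrBr avg_W2 lambdaE; ring.
Qed.

Let deficit_ge0 : 0 <= m * avg (fun x => Y x ^+ 2) - sigma ^+ 2.
Proof.
rewrite deficitE mulr_ge0//; apply: avg_ge0 => p.
have [->|Yn0] := eqVneq (Y p.2) 0; first by rewrite mul0r.
by rewrite mulr_ge0// subr_ge0 V'_le// lt_neqAle eq_sym Yn0 Y_ge0.
Qed.

Let b_le : m * `|avg b| <=
  c / sigma * (m * avg (fun x => Y x ^+ 2) - sigma ^+ 2).
Proof.
rewrite deficitE.
rewrite mulrCA ler_wpM2l// (le_trans (normr_avg _))// -avgZ; apply: le_avg => p.
rewrite /b normrM (ger0_norm (Y_ge0 _)).
have [->|Yn0] := eqVneq (Y p.2) 0; first by rewrite !mul0r mulr0.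
have Y0 : 0 < Y p.2 by rewrite lt_neqAle eq_sym Yn0 Y_ge0.
have := f_lip (w (W p.1 + Y p.2)) (w (V' p)).
have -> : w (W p.1 + Y p.2) - w (V' p) = sigma^-1 * (W p.1 + Y p.2 - V' p).
  by rewrite /w; ring.
rewrite normrM (gtr0_norm (x := sigma^-1)) ?invr_gt0//.
rewrite (ger0_norm (x := W p.1 + _ - _)) ?subr_ge0 ?V'_le// => H.
have := ler_wpM2l (Y_ge0 p.2) H; move=> /le_trans; apply.
by rewrite le_eqVlt; apply/orP; left; apply/eqP; ring.
Qed.

(** Write [y2 = avg (Y ^+ 2)], so that [avg (w f(w)) = m / sigma (avg a - avg b)].
    The number [sigma / y2 * avg a] approximates [avg f'] with an error
    controlled by the Taylor remainder.  Its actual weight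
    [m * y2 / sigma ^+ 2] in [avg (w f(w))] exceeds [1] by
    [(m * y2 - sigma ^+ 2) / sigma ^+ 2]; this excess and [avg b] each contribute
    at most [c] times that ratio. *)
Lemma stein_size_bias :
  `|avg (fun x => f' (w (W x))) - avg (fun x => w (W x) * f (w (W x)))| <=
  avg (fun x => Y x ^+ 3) / (sigma * avg (fun x => Y x ^+ 2)) +
  2 * c / sigma ^+ 2 * (m * avg (fun x => Y x ^+ 2) - sigma ^+ 2).
Proof.
have s0 := sigma_gt0; have sn0 : sigma != 0 by rewrite gt_eqF.
have ssq0 : 0 < sigma ^+ 2 by rewrite exprn_gt0.
rewrite avg_wfw; move: a_taylor a_le b_le deficit_ge0.
set y2 := avg (fun x => Y x ^+ 2); set y3 := avg (fun x => Y x ^+ 3).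
set F := avg (fun x => f' (w (W x))); set A := avg a; set B := avg b.
move=> hA cA hB def0.
have y2_ge0 : 0 <= y2 by apply: avg_ge0 => x; exact: sqr_ge0.
have y2_gt0 : 0 < y2.
  rewrite lt_neqAle y2_ge0 andbT; apply/eqP => y20.
  by move: def0; rewrite -y20 mulr0; lra.
have -> : F - sigma^-1 * m * (A - B) = - (sigma / y2 * (A - sigma^-1 * y2 * F))
   - sigma / y2 * A * ((m * y2 - sigma ^+ 2) / sigma ^+ 2) + sigma^-1 * (m * B).
  by field; rewrite sn0 gt_eqF.
have sy0 : 0 <= sigma / y2 by rewrite divr_ge0// ltW.
rewrite (le_trans (ler_normD _ _))// (_ : 2 * c / _ * _ =
  c * ((m * y2 - sigma ^+ 2) / sigma ^+ 2) +
  sigma^-1 * (c / sigma * (m * y2 - sigma ^+ 2))); last by field.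
rewrite addrA lerD//; last first.
  have si0 : 0 < sigma^-1 by rewrite invr_gt0.
  rewrite (normrM sigma^-1) (normrM m) (gtr0_norm si0) (ger0_norm m_ge0).
  exact: (ler_wpM2l (ltW si0) hB).
rewrite (le_trans (ler_normB _ _))// normrN lerD//.
  rewrite normrM (ger0_norm sy0) (le_trans (ler_wpM2l sy0 hA))//.
  by rewrite le_eqVlt; apply/orP; left; apply/eqP; field; rewrite sn0 gt_eqF.
rewrite normrM (ger0_norm (x := _ / sigma ^+ 2)) ?divr_ge0 ?(ltW ssq0)//.
rewrite ler_wpM2r ?divr_ge0 ?(ltW ssq0)// normrM (ger0_norm sy0).
rewrite (le_trans (ler_wpM2l sy0 cA))//.
by rewrite le_eqVlt; apply/orP; left; apply/eqP; field; rewrite sn0 gt_eqF.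
Qed.

End stein_size_bias.

(** * Averages over the allocations *)

Section urn_averages.
Variables (R : realFieldType) (n m k : nat) (j0 : 'I_m).
Local Notation Omega := {ffun 'I_n -> 'I_m}.
Local Notation Y := (@overflow n m k).
Local Notation W := (@total_overflow n m k).
Implicit Types x : Omega.

(** Permuting the urns preserves the uniform law: all overflows, and all pairs of
    overflows of distinct urns, have the same averages. *)
Definition relabel (s : {perm 'I_m}) x : Omega := [ffun i => s (x i)].

Lemma relabelK s : cancel (relabel s) (relabel s^-1%g).
Proof. by move=> x; apply/ffunP => i; rewrite !ffunE permK. Qed.

Lemma overflow_relabel s x j : Y (relabel s x) (s j) = Y x j.
Proof.
rewrite /overflow /balls_in; congr (_.+1 - _)%N; congr #|pred_of_set _|.
by apply/setP => i; rewrite !inE ffunE (inj_eq perm_inj).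
Qed.

Lemma total_overflow_relabel s x : W (relabel s x) = W x.
Proof.
rewrite /total_overflow (reindex_inj (@perm_inj _ s)).
by apply: eq_bigr => j _; rewrite overflow_relabel.
Qed.

Lemma avg_relabel s (g : Omega -> R) : avg (g \o relabel s) = avg g.
Proof.
rewrite /avg; congr (_ / _); rewrite [RHS](reindex_inj (can_inj (relabelK s))).
exact: eq_bigr.
Qed.

Lemma avg_overflow j :
  avg (fun x => (Y x j)%:R) = avg (fun x => (Y x j0)%:R) :> R.
Proof.
rewrite -(avg_relabel (tperm j0 j)); apply: eq_avg => x /=.
by have := overflow_relabel (tperm j0 j) x j0; rewrite tpermL => ->.
Qed.

Lemma avg_total_overflowM (g : R -> R) :
  avg (fun x => (W x)%:R * g (W x)%:R) =
  m%:R * avg (fun x => (Y x j0)%:R * g (W x)%:R).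
Proof.
transitivity (avg (fun x => \sum_j (Y x j)%:R * g (W x)%:R)).
  by apply: eq_avg => x; rewrite -mulr_suml; congr (_ * _); exact: natr_sum.
rewrite avg_sum (eq_bigr (fun=> avg (fun x => (Y x j0)%:R * g (W x)%:R))).
  by rewrite sumr_const card_ord mulr_natl.
move=> j _; rewrite -(avg_relabel (tperm j0 j)); apply: eq_avg => x /=.
have := overflow_relabel (tperm j0 j) x j0; rewrite tpermL => ->.
by rewrite total_overflow_relabel.
Qed.

Lemma avg_overflow_pair (j1 j : 'I_m) : j != j0 -> j1 != j0 ->
  avg (fun x => (Y x j0)%:R * (Y x j)%:R) =
  avg (fun x => (Y x j0)%:R * (Y x j1)%:R) :> R.
Proof.
move=> jj0 j1j0; rewrite -(avg_relabel (tperm j1 j)); apply: eq_avg => x /=.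
have := overflow_relabel (tperm j1 j) x j1; rewrite tpermL => ->.
by have := overflow_relabel (tperm j1 j) x j0; rewrite tpermD// => ->.
Qed.

Lemma avg_total_overflow_sqr (j1 : 'I_m) : j1 != j0 ->
  avg (fun x => (W x)%:R ^+ 2) =
  m%:R * (avg (fun x => (Y x j0)%:R ^+ 2) +
          (m%:R - 1) * avg (fun x => (Y x j0)%:R * (Y x j1)%:R)) :> R.
Proof.
move=> j10; have := avg_total_overflowM id.
under eq_avg do rewrite -expr2.
move=> ->; congr (_ * _).
transitivity (avg (fun x => \sum_j (Y x j0)%:R * (Y x j)%:R) : R).
  by apply: eq_avg => x; rewrite -mulr_sumr; congr (_ * _); exact: natr_sum.
rewrite avg_sum (bigD1 j0)//=; congr (_ + _).
rewrite (eq_bigr (fun=> avg (fun x => (Y x j0)%:R * (Y x j1)%:R))); last first.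
  by move=> j jj0; exact: avg_overflow_pair.
rewrite sumr_const -[LHS]mulr_natl; congr (_ * _).
have := cardC1 j0; rewrite card_ord => E.
have m0 : (0 < m)%N by case: (m) j0 => // -[].
by rewrite -(@natrB _ m 1)// subn1 -E; congr (_%:R); apply: eq_card.
Qed.

Lemma avg_total_overflow :
  avg (fun x => (W x)%:R) = m%:R * avg (fun x => (Y x j0)%:R) :> R.
Proof.
have := avg_total_overflowM (fun=> 1).
under eq_avg do rewrite mulr1.
by under [X in _ * X]eq_avg do rewrite mulr1.
Qed.

(** [swap] preserves the uniform law on pairs and the weight given by urn [j0]. *)
Lemma avg_swap_law (g : R -> R) :
  avg (fun p : Omega * Omega => (Y p.2 j0)%:R * g (W (swap j0 p).2)%:R) =
  avg (fun x => (Y x j0)%:R * g (W x)%:R).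
Proof.
have N0 : (0 < #|Omega|)%N by apply/card_gt0P; exists [ffun=> j0].
transitivity (avg (fun p : Omega * Omega => (fun=> 1) p.1 *
    ((Y p.2 j0)%:R * g (W p.2)%:R))); last first.
  rewrite (avg_prod (fun=> 1) (fun x => (Y x j0)%:R * g (W x)%:R)).
  by rewrite avg_cst// mul1r.
rewrite /avg; congr (_ / _).
rewrite [RHS](reindex_inj (inv_inj (@swapK n m j0))).
by apply: eq_bigr => p _; rewrite mul1r overflow_swap2.
Qed.

End urn_averages.

Local Open Scope classical_set_scope.
Local Open Scope ring_scope.

(** * Integrals against the standard normal density *)

Section std_normal_density.
Variable R : realType.
Local Notation mu := (@lebesgue_measure R).

Definition phi (x : R) : R := normal_pdf 0 1 x.

Lemma phiE x : phi x = phi 0 * expR (- (x ^+ 2) / 2).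
Proof.
rewrite /phi !normal_pdfE ?oner_eq0// /normal_fun !subr0 expr1n expr0n /= oppr0.
by rewrite mul0r expR0 mulr1.
Qed.

Lemma phi0E : phi 0 = (Num.sqrt (pi *+ 2))^-1.
Proof.
rewrite /phi normal_pdfE ?oner_eq0// /normal_fun /normal_peak !subr0 expr0n /=.
by rewrite oppr0 mul0r expR0 mulr1 expr1n mul1r.
Qed.

Lemma phi_gt0 x : 0 < phi x.
Proof.
rewrite phiE phi0E mulr_gt0 ?expR_gt0// invr_gt0 sqrtr_gt0.
by rewrite pmulrn_lgt0// pi_gt0.
Qed.

Lemma phi_ge0 x : 0 <= phi x. Proof. exact/ltW/phi_gt0. Qed.

Lemma phi_neq0 x : phi x != 0. Proof. by rewrite gt_eqF// phi_gt0. Qed.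

Lemma phiN x : phi (- x) = phi x.
Proof. by rewrite phiE [RHS]phiE sqrrN. Qed.

Lemma phi_le_phi0 x : phi x <= phi 0.
Proof.
rewrite phiE ler_piMr ?phi_ge0// -expR0 ler_expR mulNr oppr_le0.
by rewrite divr_ge0// sqr_ge0.
Qed.

Lemma phi0_le1 : phi 0 <= 1.
Proof.
rewrite phi0E invf_le1; last by rewrite sqrtr_gt0 pmulrn_lgt0// pi_gt0.
rewrite -[leLHS]sqrtr1 ler_sqrt; last by rewrite pmulrn_lge0// pi_ge0.
by have := @pi_ge2 R; rewrite mulr2n; lra.
Qed.

Lemma is_derive_phi (x : R) : is_derive x (1 : R) phi (- (x * phi x)).
Proof.
rewrite (_ : phi = fun x => phi 0 * expR (- (x ^+ 2) / 2)); last first.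
  by apply/funext => y; exact: phiE.
rewrite -phiE.
have H : is_derive x (1 : R) (fun x : R => - x ^+ 2 / 2) (- x).
  by apply: is_derive_eq; rewrite /GRing.scale/=; lra.
apply: is_derive_eq; rewrite /GRing.scale /= (phiE x); ring.
Qed.

Lemma continuous_phi : continuous phi.
Proof. exact: continuous_normal_pdf (oner_neq0 _). Qed.

Lemma cvg_phi_pinfty : phi x @[x --> +oo] --> (0 : R).
Proof.
apply: (@squeeze_cvgr _ _ _ _ (cst 0) (fun x : R => expR (- (x / 2)))).
- near=> x; rewrite phi_ge0/= (phiE x) (le_trans (y := expR (- x ^+ 2 / 2)))//.
    by rewrite ler_piMl ?expR_ge0// phi0_le1.
  have x1 : 1 <= x by near: x; exact: nbhs_pinfty_ge.
  by rewrite ler_expR; nra.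
- exact: cvg_cst.
- apply: (cvg_comp (fun x => x / 2) (fun x => expR (- x))); last first.
    exact: cvgr_expR.
  by apply: gt0_cvgMly => //.
Unshelve. all: by end_near. Qed.

Lemma integrable_phi : mu.-integrable setT (EFin \o phi).
Proof. exact: integrable_normal_pdf. Qed.

Lemma Rintegral_phi : \int[mu]_x phi x = 1.
Proof. by rewrite /Rintegral integral_normal_pdf. Qed.

End std_normal_density.

Section gauss_moments.
Variable R : realType.
Local Notation mu := (@lebesgue_measure R).
Local Notation phi := (@phi R).

(** [- phi] is a primitive of [x * phi x]. *)
Lemma integral_pos_idM_phi :
  (\int[mu]_(x in `[0%R, +oo[) (x * phi x)%:E = (phi 0)%:E)%E.
Proof.
rewrite (@ge0_continuous_FTC2y _ _ (fun x => - phi x) 0 0).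
- by rewrite -EFinB; congr EFin; ring.
- by move=> x x0; rewrite mulr_ge0// phi_ge0.
- apply: continuous_subspaceT => x; apply: cvgM; first exact: cvg_id.
  exact: continuous_phi.
- by rewrite -[0]oppr0; apply: cvgN; exact: cvg_phi_pinfty.
- move=> x _; by apply: derivableN; case: (is_derive_phi x).
- apply: cvgN; apply: cvg_at_right_filter; exact: continuous_phi.
- move=> x _; rewrite derive1E; have H := is_derive_phi x.
  by rewrite derive_val /= opprK.
Qed.

Lemma measurable_funM_phi (h : R -> R) : measurable_fun [set: R] h ->
  measurable_fun [set: R] (fun x => h x * phi x).
Proof.
by move=> mh; apply: measurable_funM => //; exact: measurable_normal_pdf.
Qed.

Lemma integrable_idM_phi : mu.-integrable setT (EFin \o (fun x => x * phi x)).
Proof.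
apply/integrableP; split.
  by apply/measurable_EFinP; exact: measurable_funM_phi.
have -> : (\int[mu]_x `|(x * phi x)%:E| = \int[mu]_x (`|x| * phi x)%:E)%E.
  by apply: eq_integral => x _; rewrite /= normrM (ger0_norm (phi_ge0 _)).
rewrite ge0_symfun_integralT.
- have -> : (\int[mu]_(x in [set x | (0 <= x)%R]) (`|x| * phi x)%:E =
             \int[mu]_(x in `[0%R, +oo[) (x * phi x)%:E)%E.
    rewrite -set_itvcy; apply: eq_integral => x; rewrite inE/= in_itv/= andbT.
    by move=> x0; rewrite ger0_norm.
  by rewrite integral_pos_idM_phi -EFinM ltry.
- by move=> x; rewrite mulr_ge0// phi_ge0.
- by move=> x; apply: cvgM; [exact: norm_continuous|exact: continuous_phi].
- by move=> x /=; rewrite normrN phiN.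
Qed.

Lemma integrable_linear_growth (h : R -> R) (a b : R) :
  measurable_fun [set: R] h -> (forall x, `|h x| <= a + b * `|x|) ->
  mu.-integrable setT (EFin \o (fun x => h x * phi x)).
Proof.
move=> mh hb.
pose k x : R := a * phi x + b * (`|x| * phi x).
have := @le_integrable _ (measurableTypeR R) R mu setT measurableT
  (EFin \o (fun x => h x * phi x)) (EFin \o k).
apply.
- by apply/measurable_EFinP; exact: measurable_funM_phi.
- move=> x _ /=; rewrite lee_fin normrM (ger0_norm (phi_ge0 x)).
  apply: le_trans (ler_norm _).
  by rewrite /k mulrA -mulrDl ler_wpM2r// phi_ge0.
- rewrite (_ : EFin \o k =
    (fun x => (a%:E * (phi x)%:E + b%:E * `|(x * phi x)%:E|)%E)).
    apply: integrableD => //; apply: integrableZl => //.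
      exact: integrable_phi.
    exact: (integrable_abse (integrable_idM_phi)).
  by apply/funext => x; rewrite /= normrM (ger0_norm (phi_ge0 x)).
Qed.

End gauss_moments.

Section gauss_primitive.
Variable R : realType.
Local Notation mu := (@lebesgue_measure R).
Local Notation phi := (@phi R).

Definition gauss_lower (g : R -> R) (w : R) : R :=
  \int[mu]_(x in `]-oo, w]) (g x * phi x).

Definition gauss_upper (g : R -> R) (w : R) : R :=
  \int[mu]_(x in `]w, +oo[) (g x * phi x).

Definition gauss_mean (g : R -> R) : R := \int[mu]_x (g x * phi x).

Definition gauss_integrable (g : R -> R) :=
  mu.-integrable setT (EFin \o (fun x => g x * phi x)).

Lemma gauss_lower_upper g w : gauss_integrable g ->
  gauss_mean g = gauss_lower g w + gauss_upper g w.
Proof.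
move=> ig; rewrite /gauss_mean /gauss_lower /gauss_upper.
rewrite -(itv_setU_setT false w) Rintegral_setU//=.
- by rewrite itv_setU_setT.
- exact: disjoint_rays.
Qed.

Lemma is_derive_gauss_lower g w : gauss_integrable g -> {for w, continuous g} ->
  is_derive w (1 : R) (gauss_lower g) (g w * phi w).
Proof.
move=> ig cg.
have [||||D E] := @continuous_FTC1 R (fun x => g x * phi x) -oo%O w (w + 1).
- by rewrite ltrDl.
- exact: integrableS ig.
- by rewrite ltNyr.
- by apply: cvgM => //; exact: continuous_phi.
- by apply: DeriveDef => //; rewrite -derive1E.
Qed.

Lemma gauss_lower_le f g w : gauss_integrable f -> gauss_integrable g ->
  (forall x, x <= w -> f x <= g x) -> gauss_lower f w <= gauss_lower g w.
Proof.
move=> fi gi fg; apply: le_Rintegral => //.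
- exact: integrableS fi.
- exact: integrableS gi.
- by move=> x; rewrite /= in_itv/= => xw; rewrite ler_wpM2r ?phi_ge0// fg.
Qed.

Lemma gauss_upper_le f g w : gauss_integrable f -> gauss_integrable g ->
  (forall x, w < x -> f x <= g x) -> gauss_upper f w <= gauss_upper g w.
Proof.
move=> fi gi fg; apply: le_Rintegral => //.
- exact: integrableS fi.
- exact: integrableS gi.
- move=> x; rewrite /= in_itv/= andbT => xw.
  by rewrite ler_wpM2r ?phi_ge0// fg.
Qed.

Lemma gauss_lowerB f g w : gauss_integrable f -> gauss_integrable g ->
  gauss_lower (f \- g) w = gauss_lower f w - gauss_lower g w.
Proof.
move=> fi gi; rewrite /gauss_lower -RintegralB//; last 2 first.
- exact: integrableS fi.
- exact: integrableS gi.
by apply: eq_Rintegral => x _; rewrite /= mulrBl.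
Qed.

Lemma gauss_upperB f g w : gauss_integrable f -> gauss_integrable g ->
  gauss_upper (f \- g) w = gauss_upper f w - gauss_upper g w.
Proof.
move=> fi gi; rewrite /gauss_upper -RintegralB//; last 2 first.
- exact: integrableS fi.
- exact: integrableS gi.
by apply: eq_Rintegral => x _; rewrite /= mulrBl.
Qed.

Lemma gauss_lowerZ c g w : gauss_integrable g ->
  gauss_lower (fun x => c * g x) w = c * gauss_lower g w.
Proof.
move=> gi; rewrite /gauss_lower -RintegralZl//; last exact: integrableS gi.
by apply: eq_Rintegral => x _; rewrite /= mulrA.
Qed.

Lemma gauss_upperZ c g w : gauss_integrable g ->
  gauss_upper (fun x => c * g x) w = c * gauss_upper g w.
Proof.
move=> gi; rewrite /gauss_upper -RintegralZl//; last exact: integrableS gi.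
by apply: eq_Rintegral => x _; rewrite /= mulrA.
Qed.

End gauss_primitive.

Section gauss_cdf.
Variable R : realType.
Local Notation mu := (@lebesgue_measure R).
Local Notation phi := (@phi R).

Definition lipschitz1 (h : R -> R) := forall x y, `|h x - h y| <= `|x - y|.

Lemma continuous_lipschitz1 h : lipschitz1 h -> continuous h.
Proof.
move=> hl x; apply/cvgrPdist_le => e e0; near=> t.
rewrite (le_trans (hl _ _))//.
Unshelve. all: end_near. Qed.

Lemma measurable_lipschitz1 h : lipschitz1 h -> measurable_fun [set: R] h.
Proof. by move=> /continuous_lipschitz1; exact: continuous_measurable_fun. Qed.

Lemma gauss_integrable_lipschitz1 h : lipschitz1 h -> gauss_integrable h.
Proof.
move=> hl; apply: (@integrable_linear_growth _ _ `|h 0| 1).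
  exact: measurable_lipschitz1.
move=> x; have := hl x 0; rewrite subr0 mul1r.
by have := ler_normD (h x - h 0) (h 0); rewrite subrK; lra.
Qed.

Lemma lipschitz1_cst c : lipschitz1 (cst c).
Proof. by move=> x y; rewrite /= subrr normr0. Qed.

Lemma lipschitz1_id : lipschitz1 id. Proof. by []. Qed.

Lemma gauss_integrable_cst c : gauss_integrable (cst c : R -> R).
Proof. exact/gauss_integrable_lipschitz1/lipschitz1_cst. Qed.

Lemma gauss_integrable_id : gauss_integrable (@id R).
Proof. exact/gauss_integrable_lipschitz1/lipschitz1_id. Qed.

Lemma gauss_mean1 : gauss_mean (cst 1 : R -> R) = 1.
Proof.
rewrite /gauss_mean -[RHS](Rintegral_phi R).
by apply: eq_Rintegral => x _ /=; rewrite mul1r.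
Qed.

Lemma gauss_lowerN (g : R -> R) w :
  continuous g -> gauss_integrable (g \o -%R) ->
  (forall x, x < - w -> 0 <= g x) ->
  gauss_lower g (- w) = gauss_upper (g \o -%R) w.
Proof.
move=> cg ig g0; rewrite /gauss_lower /gauss_upper Rintegral_itv_obnd_cbnd.
  rewrite /Rintegral ge0_integration_by_substitutionNy.
  - by congr fine; apply: eq_integral => x _; rewrite /= phiN.
  - apply: continuous_subspaceT => x; apply: cvgM; first exact: cg.
    exact: continuous_phi.
  - by move=> x; rewrite in_itv/= => xw; rewrite mulr_ge0 ?phi_ge0// g0.
exact: integrableS ig.
Qed.

Definition Phi : R -> R := gauss_lower (cst 1).

Lemma gauss_upper1 w : gauss_upper (cst 1) w = 1 - Phi w.
Proof.
have := gauss_lower_upper w (gauss_integrable_cst 1).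
by rewrite gauss_mean1 -/(Phi w); lra.
Qed.

Lemma is_derive_Phi (w : R) : is_derive w (1 : R) Phi (phi w).
Proof.
rewrite -[phi w]mul1r.
apply: (is_derive_gauss_lower (gauss_integrable_cst 1)); exact: cst_continuous.
Qed.

Lemma PhiN w : Phi (- w) = 1 - Phi w.
Proof.
rewrite /Phi gauss_lowerN//; first by rewrite gauss_upper1.
- by move=> x; exact: cst_continuous.
- exact: gauss_integrable_cst.
Qed.

Lemma Phi_ge0 w : 0 <= Phi w.
Proof. by apply: Rintegral_ge0 => x _; rewrite mul1r phi_ge0. Qed.

Lemma Phi_le1 w : Phi w <= 1.
Proof. by rewrite -subr_ge0 -PhiN Phi_ge0. Qed.

Lemma Phi0 : Phi 0 = 2^-1.
Proof. by have := PhiN 0; rewrite oppr0; lra. Qed.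

(** Both sides have derivative [w * phi w], so it suffices to compare them at [0],
    where reflection reduces the left one to [integral_pos_idM_phi]. *)
Lemma gauss_lower_id w : gauss_lower id w = - phi w.
Proof.
pose f w := gauss_lower id w + phi w.
suff : f w = f 0.
  rewrite /f => /eqP; rewrite -subr_eq0 => /eqP E.
  suff : gauss_lower id 0 = - phi 0 by lra.
  have := @gauss_lowerN -%R 0.
  rewrite oppr0 => /(_ _ _ _)/=.
  have -> : -%R \o -%R = @id R by apply/funext => x /=; rewrite opprK.
  have -> : gauss_lower -%R 0 = - gauss_lower id 0 :> R.
    rewrite -mulN1r -gauss_lowerZ; last exact: gauss_integrable_id.
    by congr gauss_lower; apply/funext => x; rewrite mulN1r.
  rewrite /gauss_upper Rintegral_itv_obnd_cbnd; last first.
    exact: integrableS gauss_integrable_id.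
  rewrite /Rintegral integral_pos_idM_phi /= => <-; rewrite ?opprK//.
  - by move=> x; apply: opp_continuous.
  - exact: gauss_integrable_id.
  - by move=> x; rewrite oppr_ge0 => /ltW.
apply: is_derive_0_is_cst => x.
have cid : {for x, continuous (@id R)} by exact: cvg_id.
have H1 := is_derive_gauss_lower gauss_integrable_id cid.
have H2 := is_derive_phi x.
by apply: is_derive_eq; rewrite subrr.
Qed.

Lemma gauss_mean_id : gauss_mean (@id R) = 0.
Proof.
rewrite (gauss_lower_upper 0 gauss_integrable_id) gauss_lower_id.
rewrite /gauss_upper Rintegral_itv_obnd_cbnd; last first.
  exact: integrableS gauss_integrable_id.
by rewrite /Rintegral integral_pos_idM_phi/=; ring.
Qed.

Lemma gauss_upper_id w : gauss_upper id w = phi w.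
Proof.
have := gauss_lower_upper w gauss_integrable_id.
by rewrite gauss_mean_id gauss_lower_id; lra.
Qed.

Lemma gauss_lower_dist w : gauss_lower (fun x => w - x) w = w * Phi w + phi w.
Proof.
have -> : (fun x => w - x) = (fun x => w * cst 1 x) \- id.
  by apply/funext => x /=; rewrite mulr1.
rewrite gauss_lowerB ?gauss_lowerZ ?gauss_lower_id ?opprK//.
- exact: gauss_integrable_cst.
- have -> : (fun x => w * cst 1 x) = cst (w * 1) by [].
  exact: gauss_integrable_cst.
- exact: gauss_integrable_id.
Qed.

Lemma gauss_upper_dist w :
  gauss_upper (fun x => x - w) w = phi w - w * (1 - Phi w).
Proof.
have -> : (fun x => x - w) = id \- (fun x => w * cst 1 x).
  by apply/funext => x /=; rewrite mulr1.
rewrite gauss_upperB ?gauss_upperZ ?gauss_upper_id ?gauss_upper1//.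
- exact: gauss_integrable_cst.
- exact: gauss_integrable_id.
- have -> : (fun x => w * cst 1 x) = cst (w * 1) by [].
  exact: gauss_integrable_cst.
Qed.

Lemma upper_mean_excess_ge0 w : 0 <= phi w - w * (1 - Phi w).
Proof.
rewrite -gauss_upper_dist; apply: Rintegral_ge0 => x /=.
by rewrite in_itv/= andbT => wx; rewrite mulr_ge0 ?phi_ge0// subr_ge0 ltW.
Qed.

Lemma lower_mean_excess_ge0 w : 0 <= phi w + w * Phi w.
Proof. by have := upper_mean_excess_ge0 (- w); rewrite phiN PhiN; lra. Qed.

End gauss_cdf.

(** * Inequalities for the normal distribution function *)

Section mills.
Variable R : realType.
Local Notation phi := (@phi R).
Local Notation Phi := (@Phi R).

Lemma is_derive_continuous (f df : R -> R) (D : interval R) :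
  (forall x, x \in D -> is_derive x (1 : R) f (df x)) ->
  {within [set` D], continuous f}.
Proof.
move=> fd; apply: derivable_within_continuous => x xD.
by case: (fd x xD).
Qed.

Lemma ge0_of_derive_ge0 (f df : R -> R) (a : R) :
  (forall x : R, is_derive x (1 : R) f (df x)) ->
  0 <= f a -> (forall x, a <= x -> 0 <= df x) -> forall x, a <= x -> 0 <= f x.
Proof.
move=> fd f0 df0 x ax.
have fd' y : y \in `]a, x[ -> is_derive y (1 : R) f (df y).
  by move=> _; exact: fd.
have fc := @is_derive_continuous f df `[a, x]%R (fun y _ => fd y).
have [c] := MVT_segment ax fd' fc.
rewrite in_itv/= => /andP[ac _] E.
have : 0 <= df c * (x - a) by rewrite mulr_ge0 ?df0// subr_ge0.
by rewrite -E; lra.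
Qed.

(** A nonincreasing function is at least its limit inferior at infinity, and here
    the lower bound [- 2 * phi] tends to [0]. *)
Lemma ge0_of_derive_le0 (f df : R -> R) :
  (forall x : R, 0 < x -> is_derive x (1 : R) f (df x)) ->
  (forall x, 0 < x -> df x <= 0) ->
  (forall x, 1 <= x -> - (2 * phi x) <= f x) ->
  forall x, 0 < x -> 0 <= f x.
Proof.
move=> fd df0 fphi x x0; rewrite leNgt; apply/negP => fx0.
near (pinfty_nbhs R) => N.
have xN : x <= N by near: N; apply: nbhs_pinfty_ge; exact: num_real.
have N1 : 1 <= N by near: N; apply: nbhs_pinfty_ge; exact: num_real.
have pN : `|0 - phi N| <= - f x / 4.
  near: N; move: (@cvg_phi_pinfty R) => /cvgrPdist_le; apply.
  by rewrite divr_gt0// oppr_gt0.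
have fd' y : y \in `]x, N[ -> is_derive y (1 : R) f (df y).
  by rewrite in_itv/= => /andP[xy _]; apply: fd; lra.
have fd'' y : y \in `[x, N]%R -> is_derive y (1 : R) f (df y).
  by rewrite in_itv/= => /andP[xy _]; apply: fd; lra.
have fc := is_derive_continuous fd''.
have [c] := MVT_segment xN fd' fc.
rewrite in_itv/= => /andP[cx _] E.
have c0 : 0 < c by lra.
have := df0 _ c0; have := fphi _ N1; move: pN E.
rewrite sub0r normrN ger0_norm ?phi_ge0// => pN E h1 h2.
have : 0 <= - df c * (N - x) by apply: mulr_ge0; lra.
by rewrite mulNr -E; lra.
Unshelve. all: end_near. Qed.

(** The classical lower bound on the Mills ratio: the derivative of the difference
    is [- 2 * phi x / (1 + x ^+ 2) ^+ 2]. *)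
Lemma mills_ratio_lower_bound w : 0 < w ->
  0 <= (1 - Phi w) - w * phi w / (1 + w ^+ 2).
Proof.
pose f (x : R) := (1 - Phi x) - x * phi x / (1 + x ^+ 2).
pose df (x : R) := - (2 * phi x / (1 + x ^+ 2) ^+ 2).
apply: (@ge0_of_derive_le0 f df).
- move=> x x0.
  have h1 := is_derive_Phi x; have h2 := is_derive_phi x.
  have x1 : 1 + x ^+ 2 != 0 by rewrite gt_eqF// ltr_wpDr// sqr_ge0.
  have h3 : is_derive x (1 : R) (fun x : R => 1 + x ^+ 2) (2 * x).
    by apply: is_derive_eq; rewrite /GRing.scale/=; ring.
  have h4 := @is_deriveV R (fun x : R => 1 + x ^+ 2) x _ _ x1 h3.
  apply: is_derive_eq; rewrite /df /GRing.scale/=; field.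
  by move: x1; rewrite !expr2.
- move=> x x0; rewrite /df oppr_le0 divr_ge0 ?sqr_ge0// mulr_ge0 ?phi_ge0//.
- move=> x x1; rewrite /f; have := Phi_le1 x; have := phi_ge0 x.
  have : x * phi x / (1 + x ^+ 2) <= phi x.
    rewrite ler_pdivrMr; last by rewrite ltr_wpDr// sqr_ge0.
    rewrite mulrC ler_wpM2l ?phi_ge0//; nra.
  by lra.
Qed.

Lemma mills_ratio_upper w : 0 <= (1 + w ^+ 2) * (1 - Phi w) - w * phi w.
Proof.
have w1 : 0 < 1 + w ^+ 2 by rewrite ltr_wpDr// sqr_ge0.
have [w0|w0] := ltP 0 w.
  have := mulr_ge0 (ltW w1) (mills_ratio_lower_bound w0).
  by rewrite mulrBr mulrCA divff ?mulr1// gt_eqF.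
rewrite subr_ge0 (le_trans (y := 0))//.
  by rewrite mulr_le0_ge0// phi_ge0.
by rewrite mulr_ge0 ?(ltW w1)// subr_ge0 Phi_le1.
Qed.

Lemma mills_ratio_lower w : 0 <= (1 + w ^+ 2) * Phi w + w * phi w.
Proof. by have := mills_ratio_upper (- w); rewrite phiN PhiN sqrrN; lra. Qed.

Lemma Phi_le_tangent w : 0 <= w -> 0 <= 2 * w * phi 0 - (2 * Phi w - 1).
Proof.
pose f x := 2 * x * phi 0 - (2 * Phi x - 1).
pose df x := 2 * (phi 0 - phi x).
apply: (@ge0_of_derive_ge0 f df 0).
- move=> x; have h1 := is_derive_Phi x.
  by apply: is_derive_eq; rewrite /df /GRing.scale/=; ring.
- by rewrite /f Phi0; lra.
- by move=> x _; rewrite /df mulr_ge0// subr_ge0 phi_le_phi0.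
Qed.

Lemma Phi_second_order w : 0 <= w ->
  0 <= w ^+ 2 * phi 0 - w * (2 * Phi w - 1) - 2 * phi w + 2 * phi 0.
Proof.
pose f x :=
  x ^+ 2 * phi 0 - x * (2 * Phi x - 1) - 2 * phi x + 2 * phi 0.
pose df x := 2 * x * phi 0 - (2 * Phi x - 1).
apply: (@ge0_of_derive_ge0 f df 0).
- move=> x; have h1 := is_derive_Phi x; have h2 := is_derive_phi x.
  by apply: is_derive_eq; rewrite /df /GRing.scale/=; ring.
- by rewrite /f; lra.
- by move=> x; exact: Phi_le_tangent.
Qed.

(** The difference has derivative [- phi x / x ^+ 3] times the quantity of
    [Phi_second_order] and vanishes at infinity. *)
Lemma mean_excess_product_aux w : 0 < w ->
  0 <= Phi w * (1 - Phi w)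
       - phi w * (phi w + w * (2 * Phi w - 1) - phi 0) / w ^+ 2.
Proof.
pose f x := Phi x * (1 - Phi x)
  - phi x * (phi x + x * (2 * Phi x - 1) - phi 0) / x ^+ 2.
pose df x := - (phi x / x ^+ 3
   * (x ^+ 2 * phi 0 - x * (2 * Phi x - 1) - 2 * phi x + 2 * phi 0)).
apply: (@ge0_of_derive_le0 f df).
- move=> x x0; have h1 := is_derive_Phi x; have h2 := is_derive_phi x.
  have x1 : x ^+ 2 != 0 by rewrite expf_neq0// gt_eqF.
  have h3 : is_derive x (1 : R) (fun x : R => x ^+ 2) (2 * x).
    by apply: is_derive_eq; rewrite /GRing.scale/=; ring.
  have h4 := @is_deriveV R (fun x : R => x ^+ 2) x _ _ x1 h3.
  apply: is_derive_eq; rewrite /df /GRing.scale/=; field.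
  by rewrite gt_eqF.
- move=> x x0; rewrite /df oppr_le0; apply: mulr_ge0.
    by rewrite divr_ge0 ?phi_ge0 ?exprn_ge0 ?ltW.
  exact/Phi_second_order/ltW.
- move=> x x1; rewrite /f; have p0 := Phi_ge0 x; have p1 := Phi_le1 x.
  have h0 := phi_ge0 x; have h1 := phi_le_phi0 x; have h2 := phi0_le1 R.
  have : phi x * (phi x + x * (2 * Phi x - 1) - phi 0) / x ^+ 2 <= 2 * phi x.
    rewrite ler_pdivrMr; last by nra.
    rewrite mulrC mulrAC ler_wpM2r//; nra.
  have : 0 <= Phi x * (1 - Phi x) by apply: mulr_ge0; lra.
  by lra.
Qed.

(** The product of the mean distances to [w] from either side, relative to
    [phi w], is largest at [w = 0].  This is what makes [2 * phi 0] the sharp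
    constant in [stein'_bound].  Expanding the product, with
    [Phi w * (1 - Phi w)] as the coefficient of [- w ^+ 2], turns the claim into
    [mean_excess_product_aux]. *)
Lemma mean_excess_product w :
  (phi w - w * (1 - Phi w)) * (phi w + w * Phi w) <= phi w * phi 0.
Proof.
wlog w0 : w / 0 <= w.
  move=> H; have [/H//|w0] := leP 0 w.
  have := H (- w); rewrite phiN PhiN oppr_ge0 => /(_ (ltW w0)); lra.
move: w0; rewrite le_eqVlt => /predU1P[<-|w0].
  by rewrite !mul0r subr0 addr0.
have := mean_excess_product_aux w0; rewrite subr_ge0 ler_pdivrMr ?exprn_gt0//.
nra.
Qed.

End mills.

(** * The solution of Stein's equation *)

Section stein_solution.
Variables (R : realType) (h : R -> R).
Hypothesis hlip : lipschitz1 h.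
Local Notation phi := (@phi R).
Local Notation Phi := (@Phi R).
Local Notation Eh := (gauss_mean h).

(** The bounded solution [f] of Stein's equation [f' - w f = h - E h(Z)]; the
    equation itself serves as the definition of [stein'], and [is_derive_stein]
    says that it is the derivative. *)
Definition stein (w : R) : R := (gauss_lower h w - Eh * Phi w) / phi w.

Definition stein' (w : R) : R := w * stein w + (h w - Eh).

Lemma is_derive_stein (w : R) : is_derive w (1 : R) stein (stein' w).
Proof.
have hc : {for w, continuous h} by exact: continuous_lipschitz1.
have h1 := is_derive_gauss_lower (gauss_integrable_lipschitz1 hlip) hc.
have h2 := is_derive_Phi w.
have h3 := @is_deriveV R phi w _ _ (phi_neq0 w) (is_derive_phi w).
apply: is_derive_eq; rewrite /stein' /stein /GRing.scale/=; field.
exact: phi_neq0.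
Qed.

Let gint := gauss_integrable_lipschitz1 hlip.

(* Recentring [h] at [w] expresses [stein w] and [stein' w] as combinations of
   the two one-sided integrals of [h - h w], whose sizes are bounded by the mean
   distances to [w].  This makes sense for every Lipschitz [h]. *)
Let left_dev (w : R) := gauss_lower (h \- cst (h w)) w.
Let right_dev (w : R) := gauss_upper (h \- cst (h w)) w.

Let left_devE w : left_dev w = gauss_lower h w - h w * Phi w.
Proof.
rewrite /left_dev gauss_lowerB//; last exact: gauss_integrable_cst.
congr (_ - _); rewrite -gauss_lowerZ; last exact: gauss_integrable_cst.
by congr gauss_lower; apply/funext => x /=; rewrite mulr1.
Qed.

Let right_devE w : right_dev w = Eh - gauss_lower h w - h w * (1 - Phi w).
Proof.
rewrite /right_dev gauss_upperB//; last exact: gauss_integrable_cst.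
rewrite (gauss_lower_upper w gint) [gauss_lower _ _ + _]addrC addrK.
rewrite -gauss_upper1 -gauss_upperZ; last exact: gauss_integrable_cst.
by congr (_ - gauss_upper _ _); apply/funext => x /=; rewrite mulr1.
Qed.

Let gauss_integrable_dev c : gauss_integrable (h \- cst c).
Proof.
apply: gauss_integrable_lipschitz1 => x y /=.
by rewrite opprB addrA subrK; exact: hlip.
Qed.

Let left_dev_le w : `|left_dev w| <= w * Phi w + phi w.
Proof.
rewrite -gauss_lower_dist /left_dev.
have i1 := gauss_integrable_dev (h w).
have i2 : gauss_integrable (fun x => w - x).
  apply: gauss_integrable_lipschitz1 => x y.
  by rewrite opprB addrC addrA subrK -normrN opprB.
have i3 : gauss_integrable (fun x => - 1 * (w - x)).
  apply: gauss_integrable_lipschitz1 => x y.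
  by rewrite !mulN1r !opprB addrA subrK.
rewrite ler_norml; apply/andP; split.
  rewrite -mulN1r -gauss_lowerZ//; apply: gauss_lower_le => // x xw /=.
  have := hlip x w; rewrite (ler0_norm (x := x - w)) ?subr_le0// ler_norml; lra.
apply: gauss_lower_le => // x xw /=.
have := hlip x w; rewrite (ler0_norm (x := x - w)) ?subr_le0// ler_norml; lra.
Qed.

Let right_dev_le w : `|right_dev w| <= phi w - w * (1 - Phi w).
Proof.
rewrite -gauss_upper_dist /right_dev.
have i1 := gauss_integrable_dev (h w).
have i2 : gauss_integrable (fun x => x - w).
  apply: gauss_integrable_lipschitz1 => x y.
  by rewrite opprB addrA subrK.
have i3 : gauss_integrable (fun x => - 1 * (x - w)).
  apply: gauss_integrable_lipschitz1 => x y.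
  by rewrite !mulN1r !opprB addrC addrA subrK -normrN opprB.
rewrite ler_norml; apply/andP; split.
  rewrite -mulN1r -gauss_upperZ//; apply: gauss_upper_le => // x xw /=.
  have := hlip x w; rewrite (ger0_norm (x := x - w)) ?subr_ge0 ?(ltW xw)//.
  by rewrite ler_norml; lra.
apply: gauss_upper_le => // x xw /=.
have := hlip x w; rewrite (ger0_norm (x := x - w)) ?subr_ge0 ?(ltW xw)//.
by rewrite ler_norml; lra.
Qed.

Let steinM_phi w :
  stein w * phi w = (1 - Phi w) * left_dev w - Phi w * right_dev w.
Proof. rewrite left_devE right_devE /stein divfK ?phi_neq0//; ring. Qed.

Let stein'M_phi w : stein' w * phi w =
  - (phi w - w * (1 - Phi w)) * left_dev w - (phi w + w * Phi w) * right_dev w.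
Proof.
by rewrite /stein' mulrDl -(mulrA w) steinM_phi left_devE right_devE; ring.
Qed.

(** Both one-sided integrals enter with the mean distance to the other side as
    coefficient, so their contributions are bounded by the same product. *)
Lemma stein'_bound w : `|stein' w| <= 2 * phi 0.
Proof.
rewrite -(ler_pM2r (phi_gt0 w)) -{1}(gtr0_norm (phi_gt0 w)) -normrM stein'M_phi.
have := mean_excess_product w.
have := left_dev_le w; have := right_dev_le w.
have := upper_mean_excess_ge0 w; have := lower_mean_excess_ge0 w.
rewrite ![w * Phi w + _]addrC.
set a := phi w + _; set b := phi w - _.
set x := left_dev w; set y := right_dev w.
move=> a0 b0 yb xa ab.
rewrite (le_trans (ler_normB _ _))// !normrM normrN.
rewrite (ger0_norm a0) (ger0_norm b0).
have := ler_wpM2l a0 yb; have := ler_wpM2l b0 xa; lra.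
Qed.

Let d_idM_stein w : stein w + w * stein' w =
  (((1 + w ^+ 2) * (1 - Phi w) - w * phi w) * left_dev w
   - ((1 + w ^+ 2) * Phi w + w * phi w) * right_dev w) / phi w.
Proof.
apply: (mulIf (phi_neq0 w)); rewrite divfK ?phi_neq0// mulrDl -(mulrA w).
by rewrite stein'M_phi steinM_phi; ring.
Qed.

(** With the extremal values of the one-sided integrals the bracket collapses to
    exactly [phi w]; its two coefficients are nonnegative by the Mills bounds. *)
Let d_idM_stein_bound w : `|stein w + w * stein' w| <= 1.
Proof.
rewrite d_idM_stein normrM normfV (gtr0_norm (phi_gt0 w)).
rewrite ler_pdivrMr ?phi_gt0//.
have := mills_ratio_upper w; have := mills_ratio_lower w.
have := left_dev_le w; have := right_dev_le w.
move=> yb xa a0 b0.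
rewrite (le_trans (ler_normB _ _))// !normrM (ger0_norm a0) (ger0_norm b0).
have := ler_wpM2l a0 yb; have := ler_wpM2l b0 xa; lra.
Qed.

(** [stein'] is the sum of [w * stein w], whose derivative is at most [1], and
    of the 1-Lipschitz function [h]. *)
Lemma stein'_lipschitz x y : `|stein' x - stein' y| <= 2 * `|x - y|.
Proof.
wlog yx : x y / y <= x.
  move=> H; have [|/ltW] := leP y x; first exact: H.
  by rewrite distrC (distrC x); exact: H.
pose f w := w * stein w.
pose df w := stein w + w * stein' w.
have fd w : is_derive w (1 : R) f (df w).
  have h1 := is_derive_stein w.
  by apply: is_derive_eq; rewrite /df /GRing.scale/= mulr1 addrC.
have fd' w : w \in `]y, x[ -> is_derive w (1 : R) f (df w).
  by move=> _; exact: fd.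
have fc := @is_derive_continuous R f df `[y, x]%R (fun z _ => fd z).
have [c _ E] := MVT_segment yx fd' fc.
have -> : stein' x - stein' y = df c * (x - y) + (h x - h y).
  by rewrite -E /stein' /f; ring.
rewrite (le_trans (ler_normD _ _))//.
have : `|df c * (x - y)| <= `|x - y|.
  by rewrite normrM ler_piMl// d_idM_stein_bound.
by have := hlip x y; lra.
Qed.

Lemma stein_increment x y : `|stein x - stein y| <= 2 * phi 0 * `|x - y|.
Proof.
wlog yx : x y / y <= x.
  move=> H; have [|/ltW] := leP y x; first exact: H.
  by rewrite distrC (distrC x); exact: H.
have fd' w : w \in `]y, x[ -> is_derive w (1 : R) stein (stein' w).
  by move=> _; exact: is_derive_stein.
have fc := @is_derive_continuous R stein stein' `[y, x]%R
  (fun z _ => is_derive_stein z).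
have [c _ ->] := MVT_segment yx fd' fc.
by rewrite normrM ler_wpM2r// stein'_bound.
Qed.

(** The constant is [1] rather than [2] because the Lipschitz bound on [stein'] is
    integrated; the test functions are [(z - x) ^+ 2] plus or minus the remainder. *)
Lemma stein_taylor x y : x <= y ->
  `|stein y - stein x - (y - x) * stein' x| <= (y - x) ^+ 2.
Proof.
move=> xy.
have key (s : R) : s ^+ 2 = 1 ->
    0 <= (y - x) ^+ 2 + s * (stein y - stein x - (y - x) * stein' x).
  move=> s1.
  pose f z := (z - x) ^+ 2 + s * (stein z - stein x - (z - x) * stein' x).
  pose df z := 2 * (z - x) + s * (stein' z - stein' x).
  have fd (z : R) : is_derive z (1 : R) f (df z).
    have h1 := is_derive_stein z.
    by apply: is_derive_eq; rewrite /df /GRing.scale/=; ring.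
  have fx : 0 <= f x.
    by rewrite /f !subrr mul0r subrr mulr0 expr0n addr0.
  have df0 z : x <= z -> 0 <= df z.
    move=> xz; rewrite /df; have := stein'_lipschitz z x.
    have s1' : `|s| = 1 by apply/eqP; rewrite -sqr_norm_eq1 s1.
    rewrite (ger0_norm (x := z - x)) ?subr_ge0// -[`|stein' z - _|]mul1r -s1'.
    by rewrite -normrM ler_norml; lra.
  exact: (ge0_of_derive_ge0 fd fx df0 xy).
rewrite ler_norml; apply/andP; split.
  by have := key 1 (expr1n _ _); lra.
by have := key (-1) ltac:(by rewrite sqrrN expr1n); lra.
Qed.

End stein_solution.

(** * Expectations under the normal law and under the law of the allocation *)

Section normal_expectation.
Variable R : realType.
Local Notation mu := (@lebesgue_measure R).
Local Notation phi := (@phi R).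

(** [phi] is a Radon-Nikodym derivative of the normal law: both have the same
    integral over every Borel set. *)
Lemma ge0_integral_normal_prob (f : R -> \bar R) :
  measurable_fun [set: R] f -> (forall x, (0 <= f x)%E) ->
  (\int[normal_prob 0 1]_x f x = \int[mu]_x (f x * (phi x)%:E))%E.
Proof.
move=> mf f0.
have dom := @normal_prob_dominates R 0 1.
rewrite -(Radon_Nikodym_SigmaFinite.change_of_variables dom)//.
set g := Radon_Nikodym_SigmaFinite.f _ _.
have ig : mu.-integrable setT g.
  exact: Radon_Nikodym_SigmaFinite.f_integrable.
have mphi : measurable_fun [set: R] (EFin \o phi).
  by apply/measurable_EFinP; exact: measurable_normal_pdf.
apply: ae_eq_integral => //.
- by apply: emeasurable_funM => //; exact: measurable_int ig.
- exact: emeasurable_funM.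
- apply: ae_eqe_mul2l; apply: integral_ae_eq => // E _ mE.
  by rewrite -Radon_Nikodym_SigmaFinite.f_integral.
Qed.

Lemma expectation_std_normal (d : measure_display) (T : measurableType d)
    (P : probability T R) (Z : {RV P >-> R}) (h : R -> R) :
  normally_distributed Z 0 1 -> lipschitz1 h ->
  'E_P[h \o Z]%E = (gauss_mean h)%:E.
Proof.
move=> ZN hl; rewrite unlock.
have mh : measurable_fun [set: R] (EFin \o h).
  by apply/measurable_EFinP; exact: measurable_lipschitz1.
have step (g : R -> \bar R) : measurable_fun [set: R] g ->
    (forall x, (0 <= g x)%E) ->
    (\int[P]_x (g \o Z) x = \int[mu]_x (g x * (phi x)%:E))%E.
  move=> mg g0; rewrite -ge0_integral_normal_prob//.
  have mZ : @measurable_fun _ _ T (measurableTypeR R) setT Z.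
    by move=> _ B mB; exact: (@measurable_funPT _ _ _ _ Z measurableT B mB).
  transitivity (\int[pushforward P (Z : T -> measurableTypeR R)]_x g x)%E.
    by rewrite (ge0_integral_pushforward mZ).
  by apply: eq_measure_integral => A mA _; exact: ZN.
rewrite /gauss_mean /Rintegral fineK; last first.
  by apply: integrable_fin_num => //; exact: gauss_integrable_lipschitz1.
rewrite [LHS]integralE [RHS]integralE; congr (_ - _)%E.
- transitivity (\int[P]_x ((EFin \o h)^\+ \o Z) x)%E.
    by apply: eq_integral => x _; rewrite /= !funeposE.
  rewrite (step (EFin \o h)^\+%E)//; last exact: measurable_funepos.
  apply: eq_integral => x _; rewrite !funeposE /=.
  by rewrite -!EFin_max -EFinM maxr_pMl ?phi_ge0// mul0r.
- transitivity (\int[P]_x ((EFin \o h)^\- \o Z) x)%E.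
    by apply: eq_integral => x _; rewrite /= !funenegE.
  rewrite (step (EFin \o h)^\-%E)//; last exact: measurable_funeneg.
  apply: eq_integral => x _; rewrite !funenegE /=.
  by rewrite -!EFin_max -EFinM maxr_pMl ?phi_ge0// mul0r mulNr.
Qed.

End normal_expectation.

Section uniform_law.
Variables (R : realType) (d : measure_display) (T : measurableType d).
Variables (P : probability T R) (n m k : nat) (X : 'I_n -> T -> 'I_m).
Hypothesis X_rand : forall i : 'I_n, finite_random_element (X i).
Hypothesis X_indep : mutually_independent P X.
Hypothesis X_unif : forall (i : 'I_n) (j : 'I_m),
  P (X i @^-1` [set j]) = (1 / m%:R)%:E.
Local Notation Omega := {ffun 'I_n -> 'I_m}.

Definition allocation (w : T) : Omega := [ffun i => X i w].

Let allocation_preimage (x : Omega) : allocation @^-1` [set x] =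
  \bigcap_(i in [set i | i \in [set: 'I_n]%SET]) (X i @^-1` [set x i]).
Proof.
apply/seteqP; split => w /=.
  by move=> <- i _ /=; rewrite ffunE.
by move=> H; apply/ffunP => i; rewrite ffunE; apply: H => /=; rewrite inE.
Qed.

Let measurable_allocation (x : Omega) : measurable (allocation @^-1` [set x]).
Proof.
rewrite allocation_preimage; apply: fin_bigcap_measurable => //.
by move=> i _; exact: X_rand.
Qed.

Let P_allocation (x : Omega) :
  P (allocation @^-1` [set x]) = (#|Omega|%:R^-1)%:E.
Proof.
rewrite allocation_preimage (X_indep _ (fun i => [set x i])).
under eq_bigr do rewrite X_unif.
rewrite prodEFin; congr EFin.
rewrite prodr_const cardsT card_ord card_ffun !card_ord.
by rewrite div1r exprVn natrX.
Qed.

(** The allocation is uniform on the finite set of functions, so every expectation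
    below is a finite average. *)
Lemma expectation_allocation (g : Omega -> R) :
  ('E_P[fun w => g (allocation w)] = (avg g)%:E)%E.
Proof.
rewrite unlock.
have -> : (fun w => (g (allocation w))%:E) = (fun w => \sum_(x : Omega)
    ((g x)%:E * (\1_(allocation @^-1` [set x]) w)%:E))%E.
  apply/funext => w; rewrite (bigD1 (allocation w))//= big1 ?adde0.
    by rewrite indicE mem_set// mule1.
  move=> x xw; rewrite indicE memNset ?mule0//= => E; move: xw.
  by rewrite E eqxx.
have i1 (x : Omega) : P.-integrable setT
    (fun w => (\1_(allocation @^-1` [set x]) w)%:E).
  exact: integrable_indic.
rewrite integral_sum//; last by move=> x; apply: integrableZl.
rewrite /avg mulr_suml -sumEFin; apply: eq_bigr => x _.
rewrite integralZl// integral_indic// setIT EFinM; congr (_ * _)%E.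
exact: P_allocation.
Qed.

Lemma covariance_allocation (g1 g2 : Omega -> R) : (0 < #|Omega|)%N ->
  covariance P (fun w => g1 (allocation w)) (fun w => g2 (allocation w)) =
  (avg (fun x => g1 x * g2 x) - avg g1 * avg g2)%:E.
Proof.
move=> N0; rewrite unlock !expectation_allocation/=.
pose g x := (g1 x - avg g1) * (g2 x - avg g2).
transitivity ('E_P[fun w => g (allocation w)])%E.
  by congr expectation; apply/funext.
rewrite expectation_allocation; congr EFin; rewrite {}/g.
transitivity (avg (fun x => g1 x * g2 x - (avg g1 * g2 x + avg g2 * g1 x) +
  avg g1 * avg g2)).
  by apply: eq_avg => x; ring.
by rewrite avgD avg_cst// avgB avgD !avgZ; ring.
Qed.

Lemma excess_allocation (j : 'I_m) w :
  (1 <= k)%N -> excess R X k j w = (overflow k (allocation w) j)%:R.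
Proof.
move=> k1; rewrite /excess /overflow indicE.
have -> : #|balls_in (allocation w) j| = load X j w.
  by apply: eq_card => i; rewrite !inE ffunE.
have [kl|kl] := leqP k (load X j w).
  by rewrite mem_set//= mulr1 subSn// -natr1 natrB.
rewrite memNset/=; last by apply/negP; rewrite -ltnNge.
by have /eqP -> : ((load X j w).+1 - k == 0)%N; rewrite ?mulr0// subn_eq0.
Qed.

End uniform_law.

(** * The bound *)

Lemma sqrt_8_div_pi (R : realType) : Num.sqrt (8 / pi) = 2 * (2 * phi 0) :> R.
Proof.
rewrite -[RHS]ger0_norm ?mulr_ge0 ?phi_ge0// -sqrtr_sqr; congr Num.sqrt.
have := @pi_gt0 R; rewrite phi0E; move: (@pi R) => q q0.
rewrite !exprMn exprVn sqr_sqrtr ?mulrn_wge0 ?(ltW q0)//.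
by rewrite -[q *+ 2]mulr_natr; field; rewrite gt_eqF.
Qed.

Theorem proposition9 (R : realType) (d d' : measure_display)
    (T : measurableType d) (P : probability T R)
    (T' : measurableType d') (P' : probability T' R)
    (n m k : nat) (X : 'I_n -> T -> 'I_m) (Z : {RV P' >-> R})
    (k_ge1 : (1 <= k)%N)
    (X_rand : forall i : 'I_n, finite_random_element (X i))
    (X_indep : mutually_independent P X)
    (X_unif : forall (i : 'I_n) (j : 'I_m),
      P (X i @^-1` [set j]) = (1 / m%:R)%:E)
    (Z_normal : normally_distributed Z 0 1) :
  let Y (j : nat) : T -> R := excess R X k j in
  let W : T -> R := total_excess R X k in
  let E (V : T -> R) : R := fine 'E_P[V] in
  let sigma : R := Num.sqrt (fine 'V_P[W]) in
  let Wt (w : T) : R := sigma^-1 * (W w - E W) in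
  (0 < 'V_P[W])%E ->
  (wasserstein_distance P P' Wt Z <=
    (E (fun w => Y 0%N w ^+ 3) / (sigma * E (fun w => Y 0%N w ^+ 2)) +
     Num.sqrt (8 / pi) * m%:R * sigma ^- 2 *
       ((1 - m%:R) * fine (covariance P (Y 0%N) (Y 1%N)) +
        E (Y 0%N) ^+ 2))%:E)%E.
Proof.
move=> Y W E sigma Wt.
(* Without urns [W] is constant, contradicting the positive variance. *)
case: m X X_rand X_indep X_unif @Y @W @sigma @Wt => [|m'] X X_rand X_indep X_unif
  Y W sigma Wt.
  have -> : W = cst 0 by apply/funext => w; rewrite /W /total_excess big_ord0.
  by rewrite /variance covariance_cst_l ltxx.
set j0 : 'I_m'.+1 := ord0.
pose Yf x : R := (@overflow n m'.+1 k x j0)%:R.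
pose Wf x : R := (@total_overflow n m'.+1 k x)%:R.
have N0 : (0 < #|{ffun 'I_n -> 'I_m'.+1}|)%N.
  by apply/card_gt0P; exists [ffun=> j0].
have Yfin (j : 'I_m'.+1) :
    Y j = fun w => (@overflow n m'.+1 k (allocation X w) j)%:R.
  by apply/funext => w; exact: excess_allocation.
have Y0E : Y 0%N = fun w => Yf (allocation X w) by exact: Yfin j0.
have WE : W = fun w => Wf (allocation X w).
  apply/funext => w; rewrite /W /total_excess /Wf /total_overflow natr_sum.
  by apply: eq_bigr => j _; exact: excess_allocation.
have EE (g : _ -> R) : E (fun w => g (allocation X w)) = avg g.
  by rewrite /E (expectation_allocation X_rand X_indep X_unif).
have covE := covariance_allocation X_rand X_indep X_unif.
have VE : 'V_P[W]%E = (avg (fun x => Wf x ^+ 2) - avg Wf ^+ 2)%:E.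
  rewrite /variance WE covE//; congr ((_ - _)%:E); exact: eq_avg.
rewrite VE lte_fin => V0.
have sigma2 : sigma ^+ 2 = avg (fun x => Wf x ^+ 2) - avg Wf ^+ 2.
  by rewrite /sigma VE/= sqr_sqrtr// ltW.
have sigma0 : 0 < sigma by rewrite /sigma VE sqrtr_gt0.
have lambdaE : avg Wf = m'.+1%:R * avg Yf by exact: avg_total_overflow.
(* By symmetry [E (W^2)] consists of [m] equal diagonal terms and of [m (m - 1)]
   equal cross terms. *)
have varE : m'.+1%:R * ((1 - m'.+1%:R) * fine (covariance P (Y 0%N) (Y 1%N)) +
    E (Y 0%N) ^+ 2) = m'.+1%:R * avg (fun x => Yf x ^+ 2) - sigma ^+ 2.
  rewrite sigma2 lambdaE Y0E (EE Yf).
  have [m'0|m'0] := posnP m'.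
    (* With a single urn, [W] is the excess of that urn and label [1] denotes no
       urn. *)
    have WYf : Wf =1 Yf.
      move=> x; rewrite /Wf /total_overflow (bigD1 j0)//= big1 ?addn0// => j.
      by rewrite -val_eqE /= -leqn0 -m'0 -ltnS ltn_ord.
    have m1 : m'.+1%:R = 1 :> R by rewrite m'0.
    have -> : avg (fun x => Wf x ^+ 2) = avg (fun x => Yf x ^+ 2).
      by apply: eq_avg => x; rewrite WYf.
    by rewrite m1; ring.
  pose j1 : 'I_m'.+1 := Ordinal (m'0 : (1 < m'.+1)%N).
  pose Y1f x : R := (@overflow n m'.+1 k x j1)%:R.
  have -> : Y 1%N = fun w => Y1f (allocation X w) by exact: Yfin j1.
  have -> : avg (fun x => Wf x ^+ 2) = m'.+1%:R * (avg (fun x => Yf x ^+ 2) +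
      (m'.+1%:R - 1) * avg (fun x => Yf x * Y1f x)).
    exact: avg_total_overflow_sqr.
  have Y1fE : avg Y1f = avg Yf by exact: avg_overflow.
  by rewrite covE//= Y1fE; ring.
have -> : Num.sqrt (8 / pi) * m'.+1%:R * sigma ^- 2 *
       ((1 - m'.+1%:R) * fine (covariance P (Y 0%N) (Y 1%N)) +
        E (Y 0%N) ^+ 2) = 2 * (2 * phi 0) / sigma ^+ 2 *
   (m'.+1%:R * avg (fun x => Yf x ^+ 2) - sigma ^+ 2).
  by rewrite -varE sqrt_8_div_pi; field; rewrite gt_eqF.
rewrite Y0E (EE (fun x => Yf x ^+ 3)) (EE (fun x => Yf x ^+ 2)).
apply: ub_ereal_sup => _ [h hlip <-].
pose w v := sigma^-1 * (v - avg Wf).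
have -> : 'E_P[h \o Wt]%E = (avg (fun x => h (w (Wf x))))%:E.
  rewrite -(expectation_allocation X_rand X_indep X_unif).
  by congr expectation; apply/funext => t; rewrite /= /Wt WE EE.
rewrite (expectation_std_normal Z_normal hlip) -EFinB abse_EFin lee_fin.
have -> : avg (fun x => h (w (Wf x))) - gauss_mean h =
    avg (fun x => stein' h (w (Wf x))) -
    avg (fun x => w (Wf x) * stein h (w (Wf x))).
  rewrite -avgB -[X in _ - X](avg_cst _ N0) -avgB; apply: eq_avg => x.
  by rewrite /stein'; ring.
have Yf_ge0 x : 0 <= Yf x by exact: ler0n.
have sum_Yf (g : R -> R) : avg (fun x => Wf x * g (Wf x)) =
    m'.+1%:R * avg (fun x => Yf x * g (Wf x)) by exact: avg_total_overflowM.
pose V' (p : {ffun 'I_n -> 'I_m'.+1} * {ffun 'I_n -> 'I_m'.+1}) : R :=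
  (@total_overflow n m'.+1 k (swap j0 p).2)%:R.
have V'_law (g : R -> R) : avg (fun p => Yf p.2 * g (V' p)) =
    avg (fun x => Yf x * g (Wf x)).
  exact: avg_swap_law.
have V'_le p : 0 < Yf p.2 -> V' p <= Wf p.1 + Yf p.2.
  rewrite ltr0n => /total_overflow_swap.
  by rewrite -(ler_nat R) natrD.
exact: (stein_size_bias (ler0n _ _) N0 Yf_ge0 sum_Yf V'_law V'_le sigma0 sigma2
  (stein_increment hlip) (stein_taylor hlip)).
Qed.
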